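(* Let $G$ be an involution-free abelian squareful group of infinite order $\kappa$. Then for every index set $I$ (in any ordered field) with $|I|=\kappa$, $G$ has a directed $S_\infty$-terrace for $I$.
   Context: An infinite group $G$ is squareful if $|\{g^2:g\in G\}|=|G|$. Let $\mathbb{F}$ be an ordered field and $I\subseteq\mathbb{F}$; for $d\in\mathbb{F}^+$ put $I_{(d)}=\{i\in I:i+d\in I\}$. $I$ is an index set if $|I|=|\mathbb{F}|$ and for every $d\in\mathbb{F}^+$ either $|I_{(d)}|=|\mathbb{F}|$ or $I_{(d)}=\emptyset$. For a group $G$ without involutions and a bijection $\mathbf a:I\to G$, let $\mathbf a_{(d)}(i)=\mathbf a(i)^{-1}\mathbf a(i+d)$ for $i\in I_{(d)}$; $\mathbf a$ is a directed $S_\infty$-terrace if for every $d\in\mathbb{F}^+$ with $I_{(d)}\neq\emptyset$, for each set $\{x,x^{-1}\}$ with $x\in G\setminus\{e\}$, exactly one $i\in I_{(d)}$ has $\mathbf a_{(d)}(i)\in\{x,x^{-1}\}$. *)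

(* Defs.v *)
From mathcomp Require Import all_boot all_order all_algebra.
From mathcomp Require Import boolp classical_sets functions cardinality.

Set Implicit Arguments.
Unset Strict Implicit.
Unset Printing Implicit Defensive.

Import Order.TTheory GRing.Theory Num.Theory.

Local Open Scope classical_set_scope.
Local Open Scope card_scope.

Definition abelian_group (G : groupType) : Prop :=
  forall x y : G, commute x y.

Definition involution_free (G : groupType) : Prop :=
  ~ exists x : G, x <> 1%g /\ (x ^+ 2)%g = 1%g.

(* The notion is meant for infinite groups; infiniteness is a separate
   hypothesis wherever it is used. *)
Definition squareful (G : groupType) : Prop :=
  range (fun g : G => (g ^+ 2)%g) #= [set: G].

(* Ordered fields are rendered by [realFieldType]: fields with a compatible
   total order (the norm of the structure is the induced absolute value). *)
Definition shift_set (F : realFieldType) (I : set F) (d : F) : set F :=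
  [set i | I i /\ I (i + d)%R].

Definition index_set (F : realFieldType) (I : set F) : Prop :=
  I #= [set: F] /\
  forall d : F, (0 < d)%R ->
    shift_set I d #= [set: F] \/ shift_set I d = set0.

Definition difference (F : realFieldType) (G : groupType) (a : F -> G) (d i : F)
    : G :=
  ((a i)^-1 * a (i + d)%R)%g.

(* A map with domain [I] is represented by a total function on [F] of which
   only the values on [I] matter. *)
Definition directed_terrace (F : realFieldType) (G : groupType) (I : set F)
    (a : F -> G) : Prop :=
  set_bij I [set: G] a /\
  forall d : F, (0 < d)%R -> shift_set I d <> set0 ->
    forall x : G, x <> 1%g ->
      exists! i : F,
        shift_set I d i /\ [set x; (x^-1)%g] (difference a d i).

(* Main.v *)
(** Build the terrace greedily along a well-order of its |G| requirements: every
    i in I gets a value, every g in G is taken, and every x <> 1 occurs up to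
    inversion as a difference at every distance d with I_(d) nonempty.
    Ordering the requirements so that all initial segments are smaller than |G|,
    the partial map built before any stage has fewer than |G| points, so each of
    its finitely many kinds of constraints excludes fewer than |G| candidates.
    A new index is excluded by finitely many linear equations over F, of which
    the factor 2 is invertible; a new value by equations in which it occurs once
    or squared, and squaring is injective on G.  The candidates for realizing x
    at distance d form I_(d), which has cardinality |F| = |G|. *)
Require Import Defs.
From Stdlib Require Import Wellfounded.
From mathcomp Require Import all_boot all_order all_algebra.
From mathcomp Require Import boolp classical_sets functions cardinality.
From mathcomp Require Import wochoice lra.

Set Implicit Arguments.
Unset Strict Implicit.
Unset Printing Implicit Defensive.

Import GRing.Theory.

Local Open Scope classical_set_scope.
Local Open Scope card_scope.

(** * Comparison of cardinals, products and unions *)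

(** Relations spare the construction of maps between subtypes: [R] may be multivalued, and since no
    [y] is related to two points of [A], any choice of images is injective. *)
Lemma card_le_relP T U (A : set T) (B : set U) :
  A #<= B <-> exists R : T -> U -> Prop,
    (forall x, A x -> exists2 y, B y & R x y) /\
    (forall x x' y, A x -> A x' -> R x y -> R x' y -> x = x').
Proof.
split=> [/card_leP[f]|[R [RAB Rinj]]].
  exists (fun x y => exists2 u : A, val u = x & val (f u) = y); split.
    move=> x Ax; pose u : A := SigSub (mem_set Ax).
    by exists (val (f u)); [exact: set_valP | exists u].
  move=> x x' y _ _ [u <- <-] [u' <-] /val_inj /inj; rewrite !in_setT.
  by move=> /(_ isT isT) ->.
have /choice[f fP] (u : A) : exists v : B, R (val u) (val v).
  have [y By Ruy] := RAB _ (set_valP u).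
  by exists (SigSub (mem_set By)).
apply/card_leP/injfunPex; exists f => // u v _ _ fuv.
apply/val_inj/(Rinj _ _ (val (f u))); try exact: set_valP.
  exact: fP.
by rewrite fuv.
Qed.

Lemma card_leX T T' U U' (A : set T) (A' : set T') (B : set U) (B' : set U') :
  A #<= A' -> B #<= B' -> A `*` B #<= A' `*` B'.
Proof.
move=> /card_le_relP[R [RA Rinj]] /card_le_relP[S [SB Sinj]].
apply/card_le_relP; exists (fun p q => R p.1 q.1 /\ S p.2 q.2); split.
  move=> [x y] /= [/RA[x' A'x' Rx] /SB[y' B'y' Sy]].
  by exists (x', y').
move=> [x y] [x' y'] [u v] /= [Ax By] [Ax' By'] [Rx Sy] [Rx' Sy'].
by congr pair; [exact: Rinj Rx Rx' | exact: Sinj Sy Sy'].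
Qed.

(** By Zorn's lemma there is a maximal partial injection; it is total or onto, as otherwise a pair
    of missed points would extend it. *)
Lemma card_le_total T U (A : set T) (B : set U) : A #<= B \/ B #<= A.
Proof.
pose partial_inj (M : set (T * U)) :=
  [/\ M `<=` A `*` B, (forall x y y', M (x, y) -> M (x, y') -> y = y') &
      (forall x x' y, M (x, y) -> M (x', y) -> x = x')].
have [F Fpi Ftot|M [[MAB Mfun Minj] Mmax]] := @Zorn_bigcup _ partial_inj.
  have F2 p q : (\bigcup_(X in F) X) p -> (\bigcup_(X in F) X) q ->
      exists2 X, F X & X p /\ X q.
    move=> [X FX Xp] [Y FY Yq].
    by have [/(_ _ Xp)|/(_ _ Yq)] := Ftot _ _ FX FY; [exists Y | exists X].
  split=> [p [X /Fpi[+ _ _] Xp]|x y y' My My'|x x' y Mx Mx']; first exact.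
    by have [X /Fpi[_ Xfun _] [Xy /(Xfun _ _ _ Xy)]] := F2 _ _ My My'.
  by have [X /Fpi[_ _ Xinj] [Xx /(Xinj _ _ _ Xx)]] := F2 _ _ Mx Mx'.
have [domM|/existsNP[x /not_implyP[Ax xM]]] :=
  pselect (forall x, A x -> exists y, M (x, y)).
  left; apply/card_le_relP; exists (fun x y => M (x, y)); split=> //.
    by move=> x /domM[y Mxy]; exists y => //; have [] := MAB _ Mxy.
  by move=> x x' y _ _; exact: Minj.
have [ranM|/existsNP[y /not_implyP[By yM]]] :=
  pselect (forall y, B y -> exists x, M (x, y)).
  right; apply/card_le_relP; exists (fun y x => M (x, y)); split=> //.
    by move=> y /ranM[z Mzy]; exists z => //; have [] := MAB _ Mzy.
  by move=> y y' z _ _; exact: Mfun.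
exfalso; apply: (Mmax (M `|` [set (x, y)])).
  split; last by move=> /(_ (x, y)) Mxy; apply: xM; exists y; apply: Mxy; right.
  by move=> p Mp; left.
split=> [_ [/MAB//|->//]|a b b' [Mb|[-> ->]] [Mb'|]|a a' b [Ma|[-> ->]] [Ma'|]].
- exact: Mfun Mb Mb'.
- by case=> ax _; case: xM; exists b; rewrite -ax.
- by case: xM; exists b'.
- by case.
- exact: Minj Ma Ma'.
- by case=> _ eb; case: yM; exists a; rewrite -eb.
- by case: yM; exists a'.
- by case.
Qed.

(** Two distinct points of [K] serve as tags that embed the union into the square of [K]. *)
Lemma card_le_setU T U (A B : set T) (K : set U) : infinite_set K ->
  K `*` K #<= K -> A #<= K -> B #<= K -> A `|` B #<= K.
Proof.
move=> Kinf KK /card_le_relP[R [RA Rinj]] /card_le_relP[S [SB Sinj]].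
have [k0 Kk0] := infinite_setN0 Kinf.
have [k1 [Kk1 k10]] := infinite_setN0 (infinite_setD Kinf (finite_set1 k0)).
apply: card_le_trans KK; apply/card_le_relP.
exists (fun x k => (A x /\ R x k.1 /\ k.2 = k0) \/
                   (B x /\ S x k.1 /\ k.2 = k1)); split.
  move=> x [Ax|Bx].
    by have [k Kk Rxk] := RA _ Ax; exists (k, k0) => //; left.
  by have [k Kk Sxk] := SB _ Bx; exists (k, k1) => //; right.
move=> x x' [k e] _ _ /=.
move=> [[Ax [Rx ->]]|[Bx [Sx ->]]] [[Ax' [Rx' ee]]|[Bx' [Sx' ee]]].
- exact: Rinj Rx Rx'.
- by case: k10.
- by case: k10.
- exact: Sinj Sx Sx'.
Qed.

(** * Recursion along well-orders, and initial well-orders *)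

(* [H] only sees the set of earlier values, which is all that greedy
   constructions need. *)
Lemma wf_recursion T (lt : T -> T -> Prop) U (H : T -> set U -> U) :
  well_founded lt -> exists f : T -> U, forall t, f t = H t (f @` lt^~ t).
Proof.
move=> wf; pose step t (f : forall s, lt s t -> U) :=
  H t [set u | exists s (lst : lt s t), f s lst = u].
exists (Fix wf _ step) => t; rewrite Fix_eq /step => [|{}t f g fg].
  congr H; apply/seteqP; split=> u.
    by move=> [s [lst <-]]; exists s.
  by move=> [s lst <-]; exists s, lst.
by congr H; apply/seteqP; split=> u [s [lst <-]]; exists s, lst; rewrite fg.
Qed.

Definition strict_wo T (lt : T -> T -> Prop) :=
  [/\ well_founded lt, (forall s t u, lt s t -> lt t u -> lt s u) &
      forall s t, s <> t -> lt s t \/ lt t s].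

Lemma strict_wo_min T (lt : T -> T -> Prop) (A : set T) :
  well_founded lt -> A !=set0 ->
  exists2 m, A m & forall s, A s -> ~ lt s m.
Proof.
move=> wf [x Ax]; elim: (wf x) Ax => {}x _ IH Ax.
have [[y Ay yx]|nmin] := pselect (exists2 y, A y & lt y x); first exact: IH Ay.
by exists x => // s As sx; apply: nmin; exists s.
Qed.

Lemma strict_wo_exists T : exists lt : T -> T -> Prop, strict_wo lt.
Proof.
elim/Pchoice: T => T; have [R Rwo] := well_ordering_principle T.
have Rmin (A : set T) : A !=set0 -> exists2 m, A m & forall x, A x -> R m x.
  move=> [x Ax]; have [|m [[+ mA] _]] := Rwo (mem A).
    by exists x; rewrite in_setE.
  rewrite in_setE => Am; exists m => // y Ay.
  by apply: mA; rewrite in_setE.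
have Rtot x y : R x y \/ R y x.
  have [|m [->|->] mP] := Rmin [set x; y]; first by exists x; left.
    by left; apply: mP; right.
  by right; apply: mP; left.
have Ranti x y : R x y -> R y x -> x = y.
  move=> Rxy Ryx; have [|m [_ mU]] := Rwo (mem [set x; y]).
    by exists x; rewrite in_setE; left.
  have Rrefl z : R z z by case: (Rtot z z).
  rewrite -(mU x) ?(mU y)//; split; rewrite ?in_setE; try by [left|right].
    by move=> z; rewrite in_setE => -[->|->].
  by move=> z; rewrite in_setE => -[->|->].
(* This is the strict part of the total antisymmetric [R]; its transitivity is read off from the
   least of three points. *)
exists (fun x y => ~ R y x); split=> [x|x y z nyx nzy Rzx|x y xy].
- apply: contrapT => nx.
  have [|m /= nm mP] := Rmin [set x | ~ Acc (fun x y => ~ R y x) x].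
    by exists x.
  by apply: nm; constructor => y nRmy; apply: contrapT => /mP.
- have [|m mxyz mP] := Rmin [set x; y; z]; first by exists x; left; left.
  case: mxyz => [[mE|mE]|mE].
  + by apply: nyx; case: nzy; rewrite -(Ranti x z)// -mE; apply: mP;
      [left; right | right].
  + by apply: nyx; rewrite -mE; apply: mP; left; left.
  + by apply: nzy; rewrite -mE; apply: mP; left; right.
- apply: contrapT => /not_orP[/contrapT Ryx /contrapT Rxy].
  by apply: xy; exact: Ranti.
Qed.

(** If some segment of a well-order is as large as [T], then [T] embeds into the segment of the
    least such [t]; in the order pulled back along the embedding, a large segment would make an
    earlier one large. *)
Lemma initial_wo_exists T : exists2 lt : T -> T -> Prop, strict_wo lt &
  forall t, ~ ([set: T] #<= lt^~ t).
Proof.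
have [lt [wf tr tot]] := strict_wo_exists T.
have [small|/existsNP[t0 /contrapT t0P]] :=
  pselect (forall t, ~ ([set: T] #<= lt^~ t)); first by exists lt.
have [t Tt tmin] := @strict_wo_min _ lt [set t | [set: T] #<= lt^~ t] wf
  (ex_intro _ t0 t0P).
have [R [RT Rinj]] := (card_le_relP _ _).1 Tt.
have /choice[f fP] x : exists y, lt y t /\ R x y.
  by have [//|y yt Rxy] := RT x; exists y.
have finj x y : f x = f y -> x = y.
  have [_ Rx] := fP x; have [_ Ry] := fP y => fxy.
  by apply: (Rinj _ _ (f x)) => //; rewrite fxy.
exists (fun x y => lt (f x) (f y)).
  split; first exact: wf_inverse_image.
    by move=> x y z; exact: tr.
  by move=> x y xy; apply: tot => /finj.
move=> x Tx; have [ft _] := fP x; apply: (tmin (f x)) => //=.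
apply: (card_le_trans Tx); apply/card_le_relP; exists (fun y z => z = f y).
by split=> [y|y y' _ _ _ -> /finj//]; exists (f y).
Qed.

(** * Squares of infinite sets *)

(* Goedel's ordering of [A * A], first by maximum: its initial segments are
   smaller than [A], so a greedy map [A * A -> A] never runs out of values. *)
Lemma initial_segment_sqr T (lt : T -> T -> Prop) (A : set T) :
  strict_wo lt -> infinite_set A -> (forall s t, A t -> lt s t -> A s) ->
  (forall s, A s -> ~ (A #<= lt^~ s)) ->
  (forall s, A s -> infinite_set (lt^~ s) ->
    lt^~ s `*` lt^~ s #<= lt^~ s) ->
  A `*` A #<= A.
Proof.
elim/Pchoice: T => T in lt A *.
move=> [wf tr tot] Ainf Adown Ainit Asqr.
have [L [wfL trL totL]] := strict_wo_exists (T * T).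
pose mx (p : T * T) := if `[< lt p.1 p.2 >] then p.2 else p.1.
have mxA p : (A `*` A) p -> A (mx p).
  by move=> [? ?]; rewrite /mx; case: ifP.
pose B m : set T := lt^~ m `|` [set m].
have mxB p m : mx p = m \/ lt (mx p) m -> (B m `*` B m) p.
  have Btr s t : t = m \/ lt t m -> lt s t -> lt s m.
    by move=> [->//|tm] st; exact: tr tm.
  have BE s : s = m \/ lt s m -> B m s by move=> [->|]; [right | left].
  rewrite /mx; case: asboolP => [lt12 mP|nlt12 mP].
    by split; [left; exact: Btr lt12 | exact: BE].
  split; first exact: BE.
  have [<-|/tot[//|lt21]] := pselect (p.1 = p.2); first exact: BE.
  by left; exact: Btr lt21.
pose plt p q := lt (mx p) (mx q) \/ mx p = mx q /\ L p q.
have wfp : well_founded plt.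
  move=> p; move mE : (mx p) => m.
  elim: (wf m) p mE => {}m _ IHm p; elim: (wfL p) => {}p _ IHp mE.
  constructor => q [|[qm qp]]; last by apply: IHp; rewrite ?qm.
  by rewrite mE => /IHm; apply.
have [a0 Aa0] := infinite_setN0 Ainf.
(* [f p] is a point of [A] not yet taken; the default [a0] would only come into play if the earlier
   values exhausted [A]. *)
have [f fE] := @wf_recursion _ plt _ (fun=> fun S => xget a0 (A `\` S)) wfp.
have fP p : (A `*` A) p -> A (f p) /\ forall q, plt q p -> f q <> f p.
  move=> Ap; suff /nonsubset : ~ (A `<=` f @` plt^~ p).
    move=> /(xgetPex a0); rewrite -fE => -[Afp nfp]; split=> // q qp fqp.
    by apply: nfp; exists q.
  move=> /subset_card_le /card_le_trans /(_ (card_image_le _ _)).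
  set m := mx p; have Am : A m by exact: mxA.
  (* Pairs before [p] have both entries at most [m]. Did their values cover [A], it would embed into
     the square of [B m], which is finite or no larger than the segment below [m]. *)
  have /subset_card_le pB : plt^~ p `<=` B m `*` B m.
    by move=> q qp; apply: mxB; case: qp => [|[]]; [right | left].
  move=> /card_le_trans /(_ pB) AB.
  have [mfin|minf] := pselect (finite_set (lt^~ m)).
    have Bfin : finite_set (B m) by rewrite finite_setU.
    by apply: Ainf; apply: card_le_finite AB _; exact: finite_setX.
  apply: (Ainit m) => //; apply: card_le_trans AB _.
  have Bm : B m #<= lt^~ m.
    apply: card_le_setU => //; first exact: Asqr.
    have [s sm] := infinite_setN0 minf.
    apply/card_le_relP; exists (fun _ y => y = s); split=> [x _|x x' _ -> ->//].
    by exists s.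
  by apply: card_le_trans (card_leX Bm Bm) _; exact: Asqr.
apply/card_le_relP; exists (fun p y => y = f p).
split=> [p /fP[Afp _]|p q _ Ap Aq -> fpq].
  by exists (f p).
apply: contrapT => pq.
have [|] : plt p q \/ plt q p.
- have [mpq|/tot[]] := pselect (mx p = mx q); last 2 first.
  + by left; left.
  + by right; left.
  + by have [] := totL _ _ pq; [left; right | right; right].
- by move=> /(proj2 (fP _ Aq)); apply.
- by move=> /(proj2 (fP _ Ap)); apply.
Qed.

(** Induction along an initial well-order: a segment no larger than an earlier one inherits the
    claim from it, and any other infinite segment satisfies the hypotheses of
    [initial_segment_sqr]. *)
Lemma card_setTX T : infinite_set [set: T] ->
  [set: T] `*` [set: T] #<= [set: T].
Proof.
have [lt ltwo init] := initial_wo_exists T; have [wf tr tot] := ltwo.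
move=> Tinf; apply: initial_segment_sqr ltwo Tinf _ _ _ => // t _.
elim: (wf t) => {}t _ IH tinf.
have [[s st ts]|tinit] := pselect (exists2 s, lt s t & lt^~ t #<= lt^~ s).
  have sinf : infinite_set (lt^~ s) by move=> /(card_le_finite ts).
  apply: card_le_trans (card_leX ts ts) _.
  apply: card_le_trans (IH s st sinf) _.
  by apply: subset_card_le => u; move=> us; exact: tr us st.
apply: (@initial_segment_sqr _ lt) => //.
- by move=> u v vt uv; exact: tr uv vt.
- by move=> s st ts; apply: tinit; exists s.
Qed.

Lemma infinite_card_sqr T (A : set T) : infinite_set A -> A `*` A #<= A.
Proof.
move=> Ainf; have [AT TA] : A #<= [set: A] /\ [set: A] #<= A.
  by apply/andP; rewrite -card_eq_le; exact: card_setT_sym.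
apply: card_le_trans (card_leX AT AT) _; apply: card_le_trans _ TA.
by apply: card_setTX => /(card_le_finite AT).
Qed.

(** * Sets smaller than an infinite [K], expressed as [~ (K #<= A)] *)

Section smaller.
Context {V : Type} (K : set V).
Hypothesis Kinf : infinite_set K.

Lemma smaller_finite T (A : set T) : finite_set A -> ~ (K #<= A).
Proof. by move=> Afin /card_le_finite-/(_ Afin). Qed.

(** By comparability, the product embeds into the square of the larger factor. *)
Lemma smaller_setX T U (A : set T) (B : set U) :
  ~ (K #<= A) -> ~ (K #<= B) -> ~ (K #<= A `*` B).
Proof.
suff sqr W (C : set W) : ~ (K #<= C) -> ~ (K #<= C `*` C).
  move=> KA KB KAB; have [AB|BA] := card_le_total A B.
    by apply: (sqr _ _ KB); apply: card_le_trans KAB (card_leX AB _).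
  by apply: (sqr _ _ KA); apply: card_le_trans KAB (card_leX _ BA).
move=> KC KCC; have [Cfin|Cinf] := pselect (finite_set C).
  by apply: smaller_finite KCC; exact: finite_setX.
by apply: KC; apply: card_le_trans KCC _; exact: infinite_card_sqr.
Qed.

Lemma smaller_setU T (A B : set T) :
  ~ (K #<= A) -> ~ (K #<= B) -> ~ (K #<= A `|` B).
Proof.
suff le (C D : set T) : C #<= D -> ~ (K #<= D) -> ~ (K #<= C `|` D).
  move=> KA KB; have [AB|BA] := card_le_total A B; first exact: le.
  by rewrite setUC; exact: le.
move=> CD KD; have [Dfin|Dinf] := pselect (finite_set D).
  apply: smaller_finite; rewrite finite_setU; split=> //.
  exact: card_le_finite Dfin.
move=> /card_le_trans KCD; apply/KD/KCD/card_le_setU => //.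
exact: infinite_card_sqr.
Qed.

Lemma smaller_bigcup1 T U (A : set T) (R : T -> set U) :
  ~ (K #<= A) -> (forall x, A x -> is_subset1 (R x)) ->
  ~ (K #<= \bigcup_(x in A) R x).
Proof.
move=> KA R1 /card_le_trans KR; apply/KA/KR/card_le_relP.
exists (fun y x => A x /\ R x y); split; first by move=> y [x Ax Rxy]; exists x.
by move=> y y' x _ _ [Ax Rxy] [_ Rxy']; exact: R1 Ax _ _ Rxy Rxy'.
Qed.

Lemma smaller_not_sub T (A B : set T) :
  K #<= A -> ~ (K #<= B) -> exists2 x, A x & ~ B x.
Proof.
move=> KA KB; suff /nonsubset[x []] : ~ (A `<=` B) by exists x.
by move=> /subset_card_le /(card_le_trans KA).
Qed.

(** The count behind the exclusion of candidates: an equation with three parameters from [p], and at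
    most one solution for each choice of them, bars fewer than [K] candidates. *)
Lemma smaller_solutions3 X U (p : set X) (R : X -> X -> X -> set U) :
  ~ (K #<= p) -> (forall x y z, p x -> p y -> p z -> is_subset1 (R x y z)) ->
  ~ (K #<= [set u | exists x y z, [/\ p x, p y, p z & R x y z u]]).
Proof.
move=> Kp R1 /card_le_trans Ksol.
apply: (@smaller_bigcup1 _ _ (p `*` p `*` p) (fun w => R w.1.1 w.1.2 w.2)).
- by apply: smaller_setX => //; exact: smaller_setX.
- by move=> [[x y] z] [[]]; exact: R1.
- apply: Ksol; apply: subset_card_le => u [x [y [z [px py pz Ru]]]].
  by exists (x, y, z).
Qed.
End smaller.

(** * Transfinite greedy construction *)

(** Each [t] is met at its own stage by adding two points. A violation of [rel] involves only four
    points, so it would already occur at some stage; hence goodness passes to unions of stages. *)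
Lemma transfinite_greedy (T X : Type) (rel : X -> X -> X -> X -> Prop)
    (demand : T -> X -> X -> Prop)
    (good := fun p : set X =>
      forall x y z w, p x -> p y -> p z -> p w -> rel x y z w) :
  infinite_set [set: T] ->
  (forall p, ~ ([set: T] #<= p) -> good p ->
    forall t, exists x y, demand t x y /\ good (p `|` [set x; y])) ->
  exists2 p, good p & forall t, exists x y, [/\ p x, p y & demand t x y].
Proof.
elim/Pchoice: X => X in rel demand good *.
move=> Tinf step; have [lt [wf tr tot] init] := initial_wo_exists T.
have [t0 _] := infinite_setN0 Tinf.
(* Extending the empty set supplies a point of [X], wanted as the default of [xget]. *)
have [x0 _] : exists x : X, True.
  have [||x _] := step set0 _ _ t0; last by exists x.
    by apply: smaller_finite => //; exact: finite_set0.
  by move=> ? ? ? ? [].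
pose pts (S : set (X * X)) := fst @` S `|` snd @` S.
pose H t S := xget (x0, x0)
  [set q : X * X | demand t q.1 q.2 /\ good (pts S `|` [set q.1; q.2])].
have [f fE] := wf_recursion H wf.
pose at_ x s := x = (f s).1 \/ x = (f s).2.
pose le s s' := s = s' \/ lt s s'.
pose upto t : set X := [set x | exists2 s, le s t & at_ x s].
have uptoW s t x : le s t -> upto s x -> upto t x.
  move=> st [r rs rx]; exists r => //.
  case: rs st => [->//|rs] [<-|st]; right => //; exact: tr rs st.
(* Stages increase along the well-order, so any four points of the union lie in a single
   [upto s]. *)
have directed (Q : T -> Prop) : (forall t, Q t -> good (upto t)) ->
    good [set x | exists2 s, Q s & at_ x s].
  have mx (p p' : set X) : (exists2 s, Q s & p `<=` upto s) ->
      (exists2 s, Q s & p' `<=` upto s) ->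
      exists2 s, Q s & p `|` p' `<=` upto s.
    move=> [s Qs ps] [s' Qs' ps'].
    suff [ss'|s's] : le s s' \/ le s' s.
    - by exists s' => // x [/ps/(uptoW _ _ _ ss')|/ps'].
    - by exists s => // x [/ps|/ps'/(uptoW _ _ _ s's)].
    have [->|/tot[]] := pselect (s = s'); first by left; left.
      by left; right.
    by right; right.
  have mx1 x : (exists2 s, Q s & at_ x s) ->
      exists2 s, Q s & [set x] `<=` upto s.
    by move=> [s Qs xs]; exists s => // _ ->; exists s => //; left.
  move=> Qgood x y z w /mx1 + /mx1 + /mx1 + /mx1.
  move=> /mx/[apply] /mx/[apply] /mx/[apply] [[s Qs sub]].
  by apply: Qgood Qs _ _ _ _ _ _ _ _; apply: sub;
     [left; left; left | left; left; right | left; right | right].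
have stageP t : demand t (f t).1 (f t).2 /\ good (upto t).
  elim: (wf t) => {}t _ IH; set S := f @` lt^~ t.
  have SE x : pts S x <-> exists2 s, lt s t & at_ x s.
    split=> [[[_ [s st <-] <-]|[_ [s st <-] <-]]|[s st [->|->]]].
    - by exists s => //; left.
    - by exists s => //; right.
    - by left; exists (f s) => //; exists s.
    - by right; exists (f s) => //; exists s.
  have Sgood : good (pts S).
    have /directed good_lt : forall s, lt s t -> good (upto s).
      by move=> s /IH[].
    by move=> x y z w /SE + /SE + /SE + /SE; exact: good_lt.
  (* Each earlier stage contributes two points, and the segment below [t] is smaller than [T]. *)
  have Ssmall : ~ ([set: T] #<= pts S).
    have Slt : S #<= lt^~ t by exact: card_image_le.
    by apply: smaller_setU => // TS; apply: (init t);
      apply: card_le_trans TS (card_le_trans (card_image_le _ _) Slt).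
  have [x [y xyP]] := step _ Ssmall Sgood t.
  have [] : demand t (f t).1 (f t).2 /\
            good (pts S `|` [set (f t).1; (f t).2]).
    by rewrite fE /H; apply: (@xgetPex _ _ [set q | demand t q.1 q.2 /\
      good (pts S `|` [set q.1; q.2])]); exists (x, y).
  move=> tt tgood; split=> // x1 x2 x3 x4 xt1 xt2 xt3 xt4.
  suff sub : upto t `<=` pts S `|` [set (f t).1; (f t).2].
    by apply: tgood; exact: sub.
  by move=> u [s [->|st] su]; [right | left; apply/SE; exists s].
exists [set x | exists2 s, setT s & at_ x s].
  by apply: directed => t _; have [] := stageP t.
move=> t; exists (f t).1, (f t).2; split; last by have [] := stageP t.
- by exists t => //; left.
- by exists t => //; right.
Qed.

(** * Partial terraces and the addition of one point *)

Section partial_terrace.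
Context (G : groupType) (F : realFieldType) (I : set F).
Hypothesis abG : abelian_group G.
Hypothesis invG : involution_free G.
Implicit Types (p : set (F * G)) (y z u v : F * G).

(* Points [(i, g)] encode [a i = g]. The quotients [y.2 / z.2] and
   [u.2 / v.2] are compared, up to inversion, after cross-multiplication. *)
Definition terrace_compat y z u v : Prop :=
  [/\ I y.1, (y.1 = z.1 -> y = z), (y.2 = z.2 -> y = z) &
      y.1 <> z.1 -> (y.1 - z.1 = u.1 - v.1)%R ->
      (y.2 * v.2 = u.2 * z.2)%g \/ (y.2 * u.2 = z.2 * v.2)%g -> y = u].

Definition partial_terrace p : Prop :=
  forall y z u v, p y -> p z -> p u -> p v -> terrace_compat y z u v.

Lemma partial_terrace_sub p q : p `<=` q -> partial_terrace q ->
  partial_terrace p.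
Proof. by move=> pq qT y z u v /pq ? /pq ? /pq ? /pq ?; exact: qT. Qed.

Let mulC (g h : G) : (g * h = h * g)%g. Proof. exact: abG. Qed.

Ltac by_mulC H := first [exact H | rewrite mulC; exact H |
  rewrite [RHS]mulC; exact H | rewrite mulC [RHS]mulC; exact H].

(** When the squares agree, [g / h] squares to 1 by commutativity; unless [g = h] it is an
    involution. *)
Lemma square_inj (g h : G) : (g * g = h * h)%g -> g = h.
Proof.
move=> gghh; apply: contrapT => gh; apply: invG; exists (g / h)%g; split.
  by move=> /divg1_eq.
by rewrite expg2 {1}mulC mulgA -(mulgA (h^-1)%g) gghh mulKg mulgV.
Qed.

(** In a clash of two differences the new point occurs once, or twice in crossed position ([y = v]
    or [z = u]); up to symmetry these are the last two hypotheses. Its other placements are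
    degenerate. *)
Lemma partial_terrace_add p i (g : G) : partial_terrace p -> I i ->
  (forall y, p y -> y.1 <> i /\ y.2 <> g) ->
  (forall z u v, p z -> p u -> p v -> (i - z.1 = u.1 - v.1)%R ->
     (g * v.2)%g <> (u.2 * z.2)%g /\ (g * u.2)%g <> (z.2 * v.2)%g) ->
  (forall z u, p z -> p u -> (i - z.1 = u.1 - i)%R ->
     (g * g)%g <> (z.2 * u.2)%g) ->
  partial_terrace (p `|` [set (i, g)]).
Proof.
move=> pT Ii fresh ok3 ok2 y z u v py pz pu pv.
have fun_inj w w' : (p `|` [set (i, g)]) w -> (p `|` [set (i, g)]) w' ->
    (w.1 = w'.1 -> w = w') /\ (w.2 = w'.2 -> w = w').
  move=> [pw|->] [pw'|->] //=; split=> //.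
  - by have [] := pT w w' w w.
  - by have [] := pT w w' w w.
  - by have [] := fresh _ pw.
  - by have [] := fresh _ pw.
  - by move/esym; have [] := fresh _ pw'.
  - by move/esym; have [] := fresh _ pw'.
split; [|by have [] := fun_inj _ _ py pz|by have [] := fun_inj _ _ py pz|].
  by case: py => [py|->//]; have [] := pT y y y y.
case: py pz pu pv => [py|->] [pz|->] [pu|->] [pv|->] //= yz yzuv;
  rewrite ?subrr in yzuv.
- by have [_ _ _] := pT y z u v py pz pu pv; exact.
- have [|n1 n2] := ok3 u z y pu pz py; first by lra.
  by move=> [e|e]; [case: n1; by_mulC e | case: n2; by_mulC (esym e)].
- have [|n1 n2] := ok3 v y z pv py pz; first by lra.
  by move=> [e|e]; [case: n1; by_mulC (esym e) | case: n2; by_mulC e].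
- by case: yz; lra.
- have [|n1 n2] := ok3 y v u py pv pu; first by lra.
  by move=> [e|e]; [case: n1; by_mulC (esym e) | case: n2; by_mulC (esym e)].
- by have [_ yu _ _] := pT y u y u py pu py pu; move=> _; apply: yu; lra.
- have n := ok2 v y pv py; move=> [e|e].
    by case: n; [lra | by_mulC (esym e)].
  (* The inverted equation makes [y] and [v] coincide; then [y.1 - i = i - y.1], so [y.1 = i]
     because 2 is invertible, against [yz]. *)
  have [_ _ yv _] := pT y v y v py pv py pv.
  have {}yv : y = v by apply: yv; apply: (mulIg g); by_mulC e.
  by case: yz; rewrite yv in yzuv *; lra.
- by case: yz; lra.
- have [|n1 n2] := ok3 z u v pz pu pv; first by lra.
  by move=> [e|e]; [case: n1; by_mulC e | case: n2; by_mulC e].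
- have n := ok2 z u pz pu; move=> [e|e]; first by case: n; [lra | by_mulC e].
  have [_ _ uz _] := pT u z u z pu pz pu pz.
  have {}uz : u = z by apply: uz; apply: (mulIg g); by_mulC e.
  by case: yz; rewrite -uz in yzuv *; lra.
Qed.

(** Common shape of the index equations to be avoided. With [a = 1] and [b = -1], equal points give
    [i = y.1 + e]; with [a = 2] and [b = 0] it is a shifted midpoint equation. *)
Definition line p (a b e : F) : set F :=
  [set i | exists y z v, [/\ p y, p z, p v &
     (a * i = y.1 + z.1 + b * v.1 + e)%R]].

(** Off these two lines the index equations fail, so the conditions on quotients hold vacuously and
    only the freshness of [g] remains. *)
Lemma partial_terrace_add_far p i (g : G) : partial_terrace p -> I i ->
  ~ line p 1 (-1) 0 i -> ~ line p 2 0 0 i -> (forall y, p y -> y.2 <> g) ->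
  partial_terrace (p `|` [set (i, g)]).
Proof.
move=> pT Ii far1 far2 fresh; apply: partial_terrace_add => //.
- move=> y py; split; last exact: fresh.
  by move=> yi; apply: far1; exists y, y, y; split=> //; lra.
- by move=> z u v pz pu pv e; case: far1; exists z, u, v; split=> //; lra.
- by move=> z u pz pu e; case: far2; exists z, u, u; split=> //; lra.
Qed.

(** * Meeting the three kinds of requirements *)

Context {V : Type} (K : set V).
Hypothesis Kinf : infinite_set K.
Hypothesis KG : K #<= [set: G].

Lemma smaller_line p (a b e : F) : ~ (K #<= p) -> a <> 0%R ->
  ~ (K #<= line p a b e).
Proof.
move=> Kp /eqP a0; apply: smaller_solutions3 => // y z v _ _ _ i j /= ai aj.
by apply: (mulfI a0); rewrite ai aj.
Qed.

(** The index is prescribed, so the choice is among values: an equation linear in [g] has one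
    solution, one in [g * g] at most one by [square_inj]. *)
Lemma extend_index p i : ~ (K #<= p) -> partial_terrace p -> I i ->
  exists2 y, y.1 = i & partial_terrace (p `|` [set y]).
Proof.
move=> Kp pT Ii; have [[y py yi]|pi] := pselect (exists2 y, p y & y.1 = i).
  by exists y => //; apply: partial_terrace_sub pT => z [//|->].
have [g _ /not_orP[g3 g2]] : exists2 g, [set: G] g &
    ~ ([set g | exists z u v, [/\ p z, p u, p v & g * v.2 = u.2 * z.2]] `|`
       [set g | exists z u v, [/\ p z, p u, p v & g * g = z.2 * u.2]])%g g.
  apply: (smaller_not_sub KG); apply: smaller_setU => //;
    apply: smaller_solutions3 => //.
    by move=> z u v _ _ _ g h /= <- /mulIg.
  by move=> z u v _ _ _ g h /= <- /esym/square_inj.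
exists (i, g) => //; apply: partial_terrace_add => //.
- move=> y py; split=> [yi|yg]; first by apply: pi; exists y.
  (* Three copies of [y] turn the equation into [g = y.2]. *)
  by apply: g3; exists y, y, y; split=> //; rewrite -yg.
- move=> z u v pz pu pv _; split=> e; apply: g3; first by exists z, u, v.
  by exists v, z, u.
- by move=> z u pz pu _ e; apply: g2; exists z, u, u.
Qed.

Lemma extend_value p (g : G) : K #<= I -> ~ (K #<= p) -> partial_terrace p ->
  exists2 y, y.2 = g & partial_terrace (p `|` [set y]).
Proof.
move=> KI Kp pT; have [[y py yg]|pg] := pselect (exists2 y, p y & y.2 = g).
  by exists y => //; apply: partial_terrace_sub pT => z [//|->].
have [i Ii /not_orP[far1 far2]] : exists2 i, I i &
    ~ (line p 1 (-1) 0 `|` line p 2 0 0) i.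
  by apply: (smaller_not_sub KI); apply: smaller_setU => //;
     apply: smaller_line => //; lra.
exists (i, g) => //; apply: partial_terrace_add_far => // y py yg.
by apply: pg; exists y.
Qed.

(** Unless the difference is already present, points at [i] and [i + d] with values [g] and [g * x]
    are added one after the other. *)
Lemma extend_difference p (d : F) (x : G) : (0 < d)%R -> x <> 1%g ->
  K #<= shift_set I d -> ~ (K #<= p) -> partial_terrace p ->
  exists y z, [/\ z.1 = (y.1 + d)%R, z.2 = (y.2 * x)%g \/ y.2 = (z.2 * x)%g &
    partial_terrace (p `|` [set y; z])].
Proof.
move=> d0 x1 KId Kp pT.
have [[y [z [py pz zy yzx]]]|new] := pselect (exists y z, [/\ p y, p z,
    z.1 = (y.1 + d)%R & z.2 = (y.2 * x)%g \/ y.2 = (z.2 * x)%g]).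
  exists y, z; split=> //; apply: partial_terrace_sub pT => v.
  by move=> [//|[->|->]].
have {}new y z : p y -> p z -> z.1 = (y.1 + d)%R ->
    z.2 <> (y.2 * x)%g /\ y.2 <> (z.2 * x)%g.
  by move=> py pz zy; split=> e; apply: new; exists y, z; split=> //;
     [left | right].
(* The first two lines serve the addition of [i], the other five that of [i + d]. They leave only
   equations that put two old points at distance [d]. *)
have [i [Ii Iid]] : exists2 i, shift_set I d i &
    ~ (line p 1 (-1) 0 `|` line p 2 0 0 `|` line p 1 (-1) (- d) `|`
       line p 2 0 (- d) `|` line p 1 (-1) d `|` line p 2 0 (- (2 * d)) `|`
       line p 1 (-1) (- (2 * d))) i.
  by apply: (smaller_not_sub KId); do 6?[apply: smaller_setU => //];
     apply: smaller_line => //; lra.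
move=> /not_orP[/not_orP[/not_orP[/not_orP[/not_orP[/not_orP[
  far1 far2] far3] far4] far5] far6] far7].
(* The first two conditions make [g] and [g * x] new values; the third keeps quotients [g * x / z.2]
   and [g / v.2] from being inverse to each other. *)
have [g _ /not_orP[/not_orP[g1 g2] g3]] : exists2 g, [set: G] g &
    ~ ([set g | exists y z v, [/\ p y, p z, p v & g = y.2]] `|`
       [set g | exists y z v, [/\ p y, p z, p v & g * x = y.2]] `|`
       [set g | exists y z v, [/\ p y, p z, p v & g * g * x = y.2 * z.2]])%g g.
  apply: (smaller_not_sub KG); do 2?[apply: smaller_setU => //];
    apply: smaller_solutions3 => // y z v _ _ _ g h /=.
  - by move=> -> ->.
  - by move=> <- /mulIg.
  - by move=> <- /mulIg/esym/square_inj.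
pose q := p `|` [set (i, g)].
have qT : partial_terrace q.
  apply: partial_terrace_add_far => // y py yg.
  by apply: g1; exists y, y, y; split=> //; rewrite yg.
exists (i, g), ((i + d)%R, (g * x)%g); split=> //; first by left.
rewrite setUA; apply: partial_terrace_add => //.
- move=> y [py|-> /=]; split.
  + by move=> yi; apply: far3; exists y, y, y; split=> //; lra.
  + by move=> yg; apply: g2; exists y, y, y; split=> //; rewrite yg.
  + by lra.
  + by rewrite -{1}[g]mulg1 => /mulgI/esym.
- move=> z u v [pz|->] [pu|->] [pv|->] /= e.
  + by case: far3; exists z, u, v; split=> //; lra.
  + by case: far4; exists z, u, u; split=> //; lra.
  (* Here [z] lies at distance [d] from [v]: equal quotients would realize [x] there, against [new],
     and inverse ones are barred by [g3]. *)
  + have [|n1 n2] := new v z pv pz; first by lra.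
    split=> [|gg]; first by rewrite -mulgA => /mulgI; rewrite mulC => /esym.
    by apply: g3; exists z, v, v; split=> //; rewrite -gg -!mulgA (mulC x).
  + by case: far3; exists z, z, z; split=> //; lra.
  + have [|n1 n2] := new v u pv pu; first by lra.
    rewrite (mulC u.2) -!mulgA; split=> /mulgI; rewrite mulC.
      by move/esym.
    by move/esym.
  + by case: far3; exists u, u, u; split=> //; lra.
  + by case: far5; exists v, v, v; split=> //; lra.
  + by exfalso; lra.
- move=> z u [pz|->] [pu|->] /= e.
  + by case: far6; exists z, u, u; split=> //; lra.
  + by case: far7; exists z, z, z; split=> //; lra.
  + by case: far7; exists u, u, u; split=> //; lra.
  + by exfalso; lra.
Qed.
End partial_terrace.

(** * Assembly of the terrace *)

Theorem theorem4p2 (G : groupType)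
    (abG : abelian_group G) (invG : involution_free G)
    (infG : ~ finite_set [set: G]%classic) (sqG : squareful G)
    (F : realFieldType) (I : set F)
    (idxI : index_set I) (cardI : (I #= [set: G]%classic)%card) :
  exists a : F -> G, directed_terrace I a.
Proof.
have mulC (g h : G) : (g * h = h * g)%g := abG g h.
have [IF idxId] := idxI.
have [FI GI FG] : [/\ [set: F] #<= I, [set: G] #<= I & [set: F] #<= [set: G]].
  move: IF cardI; rewrite !card_eq_le => /andP[_ FI] /andP[IG GI].
  by split=> //; exact: card_le_trans FI IG.
(* The requirements: fill an index, take a value, realize [x] at distance [d]. Their type has the
   cardinality of [G], by [GT] and [TG]. *)
pose T := (F + G + F * G)%type.
have GT : [set: G] #<= [set: T].
  apply/card_le_relP; exists (fun g t => t = inl (inr g)).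
  by split=> [g _|g h _ _ _ -> []//]; exists (inl (inr g)).
have Tinf : infinite_set [set: T] by move=> /(card_le_finite GT).
have TG : [set: T] #<= [set: G].
  have -> : [set: T] = range (fun i => inl (inl i)) `|`
      range (fun g => inl (inr g)) `|` range inr.
    apply/seteqP; split=> // -[[i|g]|dx] _.
    - by left; left; exists i.
    - by left; right; exists g.
    - by right; exists dx.
  have GG := infinite_card_sqr infG.
  do 2?[apply: card_le_setU => //];
    apply: card_le_trans (card_image_le _ _) _ => //.
  by rewrite -setXTT; apply: card_le_trans (card_leX FG _) GG.
have TI : [set: T] #<= I by exact: card_le_trans TG GI.
have TId d : (0 < d)%R -> shift_set I d <> set0 -> [set: T] #<= shift_set I d.
  move=> d0 Id0; case: (idxId d d0) => // /card_esym; rewrite card_eq_le.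
  move=> /andP[+ _]; apply: card_le_trans; apply: card_le_trans TI _.
  exact: card_leT.
pose demand (t : T) (y z : F * G) := match t with
  | inl (inl i) => I i -> y.1 = i
  | inl (inr g) => y.2 = g
  | inr (d, x) => (0 < d)%R -> shift_set I d <> set0 -> x <> 1%g ->
      z.1 = (y.1 + d)%R /\ (z.2 = (y.2 * x)%g \/ y.2 = (z.2 * x)%g)
  end.
have [|p pT pdemand] :=
  @transfinite_greedy T (F * G) (terrace_compat I) demand Tinf.
  move=> p Tp pT t.
  have value g : exists y z, y.2 = g /\ partial_terrace I (p `|` [set y; z]).
    have [y yg ypT] := extend_value abG Tinf g TI Tp pT.
    by exists y, y; rewrite setUid.
  (* A requirement whose premises fail holds for any two points, so any extension will do, such as
     the one that takes the value 1. *)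
  have dummy : (forall y z, demand t y z) ->
      exists y z, demand t y z /\ partial_terrace I (p `|` [set y; z]).
    by move=> tP; have [y [z [_ yzpT]]] := value 1%g; exists y, z.
  case: t dummy => [[i|g]|[d x]] dummy.
  - have [Ii|nIi] := pselect (I i); last by apply: dummy => ? ? /nIi.
    have [y yi ypT] := extend_index abG invG Tinf TG Tp pT Ii.
    by exists y, y; rewrite setUid; split.
  - exact: value.
  - have [[d0 [Id0 x1]]|nP] :=
      pselect ((0 < d)%R /\ shift_set I d <> set0 /\ x <> 1%g).
      have [y [z [zy yzx yzpT]]] :=
        extend_difference abG invG Tinf TG d0 x1 (TId d d0 Id0) Tp pT.
      by exists y, z.
    by apply: dummy => y z d0 Id0 x1; case: nP.
have pfun i g h : p (i, g) -> p (i, h) -> g = h.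
  by move=> pg ph; have [_ /(_ erefl)[]] := pT _ _ _ _ pg ph pg ph.
have pI y : p y -> I y.1 by move=> py; have [] := pT _ _ _ _ py py py py.
(* [p] is the graph of [a] over [I]; elsewhere [xget] returns the default 1. *)
pose a i := xget 1%g [set g | p (i, g)].
have pa i : I i -> p (i, a i).
  move=> Ii; apply: (xgetPex 1%g (P := [set g | p (i, g)])).
  by have [[j g] [_ [py _ /(_ Ii) /= <-]]] := pdemand (inl (inl i)); exists g.
have aE y : p y -> a y.1 = y.2.
  by move=> py; apply: (pfun y.1); [exact/pa/pI | rewrite -surjective_pairing].
exists a; split.
  split=> [//|i j|g _].
    rewrite !inE => Ii Ij aij.
    by have [_ _ /(_ aij)[]] :=
      pT _ _ _ _ (pa _ Ii) (pa _ Ij) (pa _ Ii) (pa _ Ij).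
  have [y [_ [py _ /= yg]]] := pdemand (inl (inr g)).
  by exists y.1; rewrite ?aE//; exact: pI.
move=> d d0 Id0 x x1.
have [y [z [py pz /(_ d0 Id0 x1)[zy yzx]]]] := pdemand (inr (d, x)).
exists y.1; split.
  split; first by split; [exact: pI | rewrite -zy; exact: pI].
  rewrite /difference -zy !aE //; case: yzx => ->; first by left; rewrite mulKg.
  by right; rewrite invgM mulgVK.
move=> i [[Ii Iid] xi]; set v := a (i + d)%R.
have {xi} xi : v = (a i * x)%g \/ v = (a i / x)%g.
  by case: xi => <-; [left | right]; rewrite ?invgK mulVKg.
(* Compatibility of [y], [z] with the points at [i] and [i + d] yields [y = (i, a i)]; each pair has
   difference [x] or its inverse, whence four cases. *)
have [_ _ _] := pT _ _ _ _ py pz (pa _ Ii) (pa _ Iid).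
have [] : y.1 <> z.1 /\ (y.1 - z.1 = i - (i + d))%R by split; lra.
move=> yz yzi /(_ yz yzi) /= -> //; rewrite -/v.
case: yzx xi => -> [] ->.
- by left; rewrite mulgA [RHS]mulgA (mulC y.2).
- by right; rewrite (mulC (a i) (x^-1)%g) mulgA mulgK.
- by right; rewrite -!mulgA (mulC x).
- by left; rewrite (mulC (a i) (x^-1)%g) mulgA mulgK mulC.
Qed.
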